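(* Let $q$ be a prime power, $\eta\ge 0$ an integer with $\eta\neq 1$, and $(\delta_T,\delta_X)\in\mathbb{Z}\times\mathbb{N}$ with $\delta:=\delta_T+\eta\delta_X\ge 0$. For every $(\epsilon_T,\epsilon_X)\in\mathbb{N}^2$ with $\epsilon_T\ge q$ and $\epsilon_X\ge q$, \[d_\eta(\delta_T,\delta_X)\ \ge\ \min_{M\in\Delta^*(\delta_T,\delta_X)}\#\{N\in\Delta^*(\epsilon_T,\epsilon_X)\,:\,M \text{ divides } N\},\] and this is an equality for $\epsilon_T=\delta_T+\eta\delta_X+q$ and $\epsilon_X=\delta_X+q$.
   Context: $R=\mathbb{F}_q[T_1,T_2,X_1,X_2]$; the bidegree of $T_1^{c_1}T_2^{c_2}X_1^{d_1}X_2^{d_2}$ is $(c_1+c_2-\eta d_1, d_1+d_2)$; $R(\delta_T,\delta_X)$ is the span of monomials of bidegree $(\delta_T,\delta_X)$. The Hirzebruch surface $\mathcal{H}_\eta$ is the quotient of $(\mathbb{A}^2\setminus\{0\})^2$ by $\mathbb{G}_m^2$ acting by $(\lambda,\mu)\cdot(t_1,t_2,x_1,x_2)=(\lambda t_1,\lambda t_2,\mu\lambda^{-\eta}x_1,\mu x_2)$; each of its $(q+1)^2$ $\mathbb{F}_q$-points has a unique representative of the form $(1,a,1,b)$, $(0,1,1,b)$, $(1,a,0,1)$ or $(0,1,0,1)$ ($a,b\in\mathbb{F}_q$), at which polynomials are evaluated. $C_\eta(\delta_T,\delta_X)$ is the image of $F\mapsto(F(P))_{P\in\mathcal{H}_\eta(\mathbb{F}_q)}$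 on $R(\delta_T,\delta_X)$, and $d_\eta(\delta_T,\delta_X)$ its minimum Hamming distance. For a bidegree $(\delta_T,\delta_X)$ with $\delta=\delta_T+\eta\delta_X\ge0$: for $(d_2,c_2)\in\mathbb{N}^2$ with $d_2\le\delta_X$, $\eta d_2+c_2\le\delta$, put $M(d_2,c_2)=T_1^{\delta-\eta d_2-c_2}T_2^{c_2}X_1^{\delta_X-d_2}X_2^{d_2}$. Let $A=\delta_X$ if $\delta_T\ge0$ and $A=\delta/\eta$ if $\delta_T<0$; $\mathcal{A}_X=\{\alpha\in\mathbb{N}:\alpha\le\min(\lfloor A\rfloor,q-1)\}\cup(\{A\}\cap\mathbb{N})$; $\mathcal{K}(\delta_T,\delta_X)=\{(\alpha,\beta)\in\mathbb{N}^2:\alpha\in\mathcal{A}_X,\ \beta\le\min(\delta-\eta\alpha,q)-1\text{ or }\beta=\delta-\eta\alpha\}$. Condition (H): $\eta\ge2$, $\delta_T<0$, $\eta\mid\delta_T$, $q\le\delta_X+\delta_T/\eta$. Let $\mathcal{K}^*(\delta_T,\delta_X)=\mathcal{K}(\delta_T,\delta_X)\setminus\{(\delta/\eta,0)\}$ if (H) holds and $=\mathcal{K}(\delta_T,\delta_X)$ otherwise, and $\Delta^*(\delta_T,\delta_X)=\{M(\alpha,\beta):(\alpha,\beta)\in\mathcal{K}^*(\delta_T,\delta_X)\}$ (the monomial $M(\alpha,\beta)$ taken with respect to the relevant bidegree). *)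

(* Defs.v *)
From HB Require Import structures.
From mathcomp Require Import all_boot all_order all_algebra.
From mathcomp Require Import mpoly.
From Stdlib Require Import ClassicalDescription.

Set Implicit Arguments.
Unset Strict Implicit.
Unset Printing Implicit Defensive.

Import Order.TTheory GRing.Theory Num.Theory.
Local Open Scope ring_scope.

Section Hirzebruch.

Variable F : finFieldType.
Variable eta : nat.

(* Variables of R = F[T1,T2,X1,X2]: index 0 = T1, 1 = T2, 2 = X1, 3 = X2. *)

Definition ix (k : nat) : 'I_4 := inord k.

Definition bideg (m : 'X_{1..4}) : int * nat :=
  ((m (ix 0))%:Z + (m (ix 1))%:Z - (eta * m (ix 2))%:Z,
   (m (ix 2) + m (ix 3))%N).

Definition in_R (dT : int) (dX : nat) (p : {mpoly F[4]}) : Prop :=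
  forall m, m \in msupp p -> bideg m = (dT, dX).

(* F_q-points of H_eta, via their unique representatives:
   (Some a, Some b) ~ (1,a,1,b), (None, Some b) ~ (0,1,1,b),
   (Some a, None) ~ (1,a,0,1),  (None, None) ~ (0,1,0,1). *)
Definition Pt : finType := (option F * option F)%type.

Definition coords (P : Pt) : 'I_4 -> F :=
  let '(t1, t2) := match P.1 with Some a => (1, a) | None => (0, 1) end in
  let '(x1, x2) := match P.2 with Some b => (1, b) | None => (0, 1) end in
  fun i : 'I_4 => nth 0 [:: t1; t2; x1; x2] i.

Definition evalcode (p : {mpoly F[4]}) : {ffun Pt -> F} :=
  [ffun P => p.@[coords P]].

Definition bool_of_Prop (P : Prop) : bool :=
  if excluded_middle_informative P then true else false.

Definition code (dT : int) (dX : nat) : {set {ffun Pt -> F}} :=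
  [set c | bool_of_Prop (exists p, in_R dT dX p /\ c = evalcode p)].

Definition hamming (c c' : {ffun Pt -> F}) : nat := #|[set P | c P != c' P]|.

(* minimum Hamming distance d_eta(dT,dX) (#|Pt| is only a neutral default,
   it bounds every distance) *)
Definition dmin (dT : int) (dX : nat) : nat :=
  \big[minn/#|Pt|]_(c in code dT dX)
     \big[minn/#|Pt|]_(c' in code dT dX | c' != c) hamming c c'.

End Hirzebruch.

Section Delta.

Variables (q eta : nat).

(* monomials as exponent tuples (c1, c2, d1, d2) of T1^c1 T2^c2 X1^d1 X2^d2 *)
Definition mono := (nat * nat * nat * nat)%type.

Definition mdivides (M N : mono) : bool :=
  let '(a1, a2, a3, a4) := M in let '(b1, b2, b3, b4) := N in
  [&& (a1 <= b1)%N, (a2 <= b2)%N, (a3 <= b3)%N & (a4 <= b4)%N].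

Variables (dT : int) (dX : nat).

Definition delta : int := dT + (eta * dX)%:Z.
Definition deltan : nat := `|delta|%N.   (* = delta, as delta >= 0 *)

(* alpha in A_X; A = dX if dT >= 0, A = delta/eta if dT < 0
   (floor(delta/eta) = delta %/ eta, and delta/eta in N iff eta | delta) *)
Definition in_AX (alpha : nat) : bool :=
  if (0 <= dT) then ((alpha <= minn dX q.-1)%N || (alpha == dX))
  else ((alpha <= minn (deltan %/ eta) q.-1)%N
        || ((eta %| deltan)%N && (alpha == deltan %/ eta)%N)).

(* (alpha, beta) in K(dT,dX);  beta <= min(delta - eta alpha, q) - 1
   is written beta < min(delta - eta alpha, q) (integers) *)
Definition in_K (ab : nat * nat) : bool :=
  let '(alpha, beta) := ab in
  in_AX alpha &&
  ((beta%:Z < Num.min (delta - (eta * alpha)%:Z) q%:Z)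
   || (beta%:Z == delta - (eta * alpha)%:Z)).

Definition K_set : seq (nat * nat) :=
  filter in_K (allpairs pair (seq.iota 0%N (deltan + dX).+1) (seq.iota 0%N deltan.+1)).

Definition condH : bool :=
  [&& (2 <= eta)%N, dT < 0, (eta%:Z %| dT)%Z & q%:Z <= dX%:Z + (dT %/ eta%:Z)%Z].

Definition Kstar : seq (nat * nat) :=
  if condH then [seq ab <- K_set | ab != (deltan %/ eta, 0)%N] else K_set.

Definition Mmono (ab : nat * nat) : mono :=
  let '(d2, c2) := ab in (deltan - eta * d2 - c2, c2, dX - d2, d2)%N.

Definition Deltastar : seq mono := undup [seq Mmono ab | ab <- Kstar].

End Delta.

Definition divcount (q eta : nat) (eT : int) (eX : nat) (M : mono) : nat :=
  count (mdivides M) (Deltastar q eta eT eX).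

Definition bound (q eta : nat) (dT : int) (dX : nat) (eT : int) (eX : nat) : nat :=
  let s := Deltastar q eta dT dX in
  \big[minn/divcount q eta eT eX (head (0,0,0,0)%N s)]_(M <- s) divcount q eta eT eX M.

(* Main.v *)
Require Import Defs.
From HB Require Import structures.
From mathcomp Require Import all_boot all_order all_algebra.
From mathcomp Require Import all_field.
From mathcomp Require Import mpoly.
From mathcomp Require Import zify.
Import Order.TTheory GRing.Theory Num.Theory.
Local Open Scope ring_scope.

(* A polynomial of bidegree (dT, dX) restricted to the rational points is
   f(t, x) = sum_d g_d(t) x^d with f(t, oo) = g_dX(t), where t and x run over
   P^1(F_q) and g_d is given by a binary form of degree delta - eta d.
   If f does not vanish identically on x = oo, put a = dX.  Otherwise reduce the
   exponents of x modulo x^q - x and let a < q be the largest exponent whose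
   coefficient is a nonzero function of t; for eta <> 1 this coefficient is still
   given by a form of degree delta - eta a, because a form of degree >= q takes
   arbitrary values on P^1(F_q).  On each fibre where it does not vanish, f has
   at least max(q-a,0) + [a = dX] nonzero values; the same count on P^1 for the
   coefficient gives
     wt f >= (max(q-a,0) + [a = dX]) (max(q-b,0) + [b = delta - eta a])
   for some (a, b) in K^*.  A product of "linear" factors with distinct roots
   attains each such value, and for large (eT, eX) the value is the number of
   multiples of M(a, b) in Delta^*(eT, eX), of which it is always an upper bound. *)

Set Implicit Arguments.
Unset Strict Implicit.

(** * Minima and cardinalities *)

Lemma leq_bigminn (I : eqType) (r : seq I) (P : pred I) (f : I -> nat) x m :
  (m <= x)%N -> (forall i, i \in r -> P i -> (m <= f i)%N) ->
  (m <= \big[minn/x]_(i <- r | P i) f i)%N.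
Proof.
move=> mx mf; rewrite big_seq_cond; elim/big_rec: _ => // i y /andP[ri Pi] my.
by rewrite leq_min mf.
Qed.

Lemma bigminn_leq (I : eqType) (r : seq I) (P : pred I) (f : I -> nat) x i :
  i \in r -> P i -> (\big[minn/x]_(i <- r | P i) f i <= f i)%N.
Proof.
elim: r => // j r IH; rewrite inE big_cons => /predU1P[<- Pi|ri Pi].
  by rewrite Pi geq_minl.
by case: ifP => _; rewrite ?geq_min IH ?orbT.
Qed.

Lemma card_pairs (A B : finType) (P : pred (A * B)) :
  #|[set x | P x]| = (\sum_a #|[set b | P (a, b)]|)%N.
Proof.
rewrite -sum1dep_card.
transitivity (\sum_(x : A * B | predT x.1 && P (x.1, x.2)) 1)%N.
  by apply: eq_bigl => -[].
rewrite -(pair_big_dep predT (fun a b => P (a, b)) (fun _ _ => 1%N)) /=.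
by apply: eq_bigr => a _; rewrite sum1dep_card.
Qed.

(** * The index set K^* and the weights of its elements *)

Section Combinatorics.

Variables q eta : nat.

(* Truncated subtractions: q - a is 0 for a >= q.  The boolean summands count the
   points at infinity of the two factors P^1. *)
Definition footprint_weight (de dX : nat) (ab : nat * nat) : nat :=
  ((q - ab.1 + (ab.1 == dX)) * (q - ab.2 + (eta * ab.1 + ab.2 == de)))%N.

Section Box.

Variables (dT : int) (dX : nat).
Hypothesis delta_ge0 : 0 <= dT + (eta * dX)%:Z.
Hypothesis q_gt0 : (0 < q)%N.

Local Notation de := (deltan eta dT dX).

Lemma deltaE : (de%:Z = dT + (eta * dX)%:Z)%R.
Proof. by rewrite /deltan /delta gez0_abs. Qed.

Lemma in_AX_bounds a : in_AX q eta dT dX a -> (a <= dX)%N /\ (eta * a <= de)%N.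
Proof.
have dE := deltaE.
rewrite /in_AX; case: ifP => dT0.
  move=> aX; have {}aX : (a <= dX)%N by lia.
  by split=> //; have := leq_mul (leqnn eta) aX; lia.
move=> aA; have {}aA : (a <= de %/ eta)%N by lia.
have e1 : (eta * a <= de)%N.
  by rewrite mulnC; apply: leq_trans (leq_divM _ eta); rewrite leq_mul.
(* As dT < 0, a > dX would give eta a >= eta dX > de. *)
split=> //; rewrite leqNgt; apply/negP => lt.
by have := leq_mul (leqnn eta) (ltnW lt); lia.
Qed.

Lemma in_KP a b : in_K q eta dT dX (a, b) =
  [&& in_AX q eta dT dX a, (eta * a + b <= de)%N &
      (b < q)%N || (eta * a + b == de)].
Proof.
rewrite /in_K /delta -deltaE; case: (boolP (in_AX _ _ _ _ _)) => //= aA.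
have [_ ea] := in_AX_bounds aA.
by apply/idP/idP; lia.
Qed.

Lemma mem_K_set ab : (ab \in K_set q eta dT dX) = in_K q eta dT dX ab.
Proof.
rewrite mem_filter; case: ab => a b.
case abK: (in_K _ _ _ _ _) => //; move: abK; rewrite in_KP => /and3P[aA eab _].
have [aX _] := in_AX_bounds aA.
by apply/allpairsP; exists (a, b); rewrite !mem_iota /=; split=> //; lia.
Qed.

Lemma uniq_K_set : uniq (K_set q eta dT dX).
Proof.
by apply/filter_uniq/allpairs_uniq; rewrite ?iota_uniq // => -[? ?] [? ?].
Qed.

Lemma sub_Kstar ab : ab \in Kstar q eta dT dX -> ab \in K_set q eta dT dX.
Proof. by rewrite /Kstar; case: ifP; rewrite // mem_filter => _ /andP[]. Qed.

Lemma Kstar_box a b : (a, b) \in Kstar q eta dT dX ->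
  (a <= dX)%N /\ (eta * a + b <= de)%N.
Proof.
by move/sub_Kstar; rewrite mem_K_set in_KP => /and3P[/in_AX_bounds[]].
Qed.

Lemma uniq_Kstar : uniq (Kstar q eta dT dX).
Proof.
by rewrite /Kstar; case: ifP => _; [apply: filter_uniq|]; apply: uniq_K_set.
Qed.

(** The pair removed under (H) has first coordinate at least q, so K and K^* agree in every column a
    < q. *)
Lemma condH_quotient : condH q eta dT dX ->
  (eta %| de)%N /\ (q <= de %/ eta)%N.
Proof.
case/and4P => eta2 dT0 /dvdzP[k dTE] qle.
have eta0 : (0 < eta)%N by lia.
have kE : (dT %/ eta%:Z)%Z = k by rewrite dTE mulzK //; lia.
rewrite kE in qle.
have [n nE] : exists n : nat, k + dX%:Z = n%:Z.
  by exists (absz (k + dX%:Z)); rewrite gez0_abs; lia.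
have dE : de = (n * eta)%N.
  by apply/eqP; rewrite -eqz_nat deltaE dTE !PoszM -nE; lia.
by rewrite dE dvdn_mull // mulnK //; lia.
Qed.

Lemma mem_Kstar_small a b : (a < q)%N ->
  ((a, b) \in Kstar q eta dT dX) = in_K q eta dT dX (a, b).
Proof.
move=> aq; rewrite -mem_K_set /Kstar; case: ifP => // /condH_quotient[_ qd].
rewrite mem_filter; case: eqP => //= -[aE _]; lia.
Qed.

Lemma in_AX_small a : (a < q)%N -> (a <= dX)%N -> (eta * a <= de)%N ->
  in_AX q eta dT dX a.
Proof.
move=> aq aX ea; rewrite /in_AX; case: ifP => dT0; first lia.
have dE := deltaE.
have eta0 : (0 < eta)%N by lia.
have : (a <= de %/ eta)%N by rewrite leq_divRL // mulnC.
lia.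
Qed.

Lemma Kstar_small a b : (a < q)%N -> (a <= dX)%N -> (eta * a + b <= de)%N ->
  (b < q)%N || (eta * a + b == de) -> (a, b) \in Kstar q eta dT dX.
Proof.
move=> aq aX eab bq.
rewrite mem_Kstar_small // in_KP eab bq in_AX_small //; lia.
Qed.

Lemma Kstar_top b : 0 <= dT -> (eta * dX + b <= de)%N ->
  (b < q)%N || (eta * dX + b == de) -> (dX, b) \in Kstar q eta dT dX.
Proof.
move=> dT0 eab bq; rewrite /Kstar /condH.
have -> : (dT < 0) = false by lia.
by rewrite andbF mem_K_set in_KP /in_AX dT0 eab bq eqxx orbT.
Qed.

(** The second factor never vanishes on K. The first one vanishes only if q <= a and a differs from
    dX; membership in A_X then forces dT < 0, a = de / eta and b = 0, so (H) holds and (a, b) is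
    exactly the pair left out of K^*. *)
Lemma footprint_weight_gt0 ab : eta != 1%N -> ab \in Kstar q eta dT dX ->
  (0 < footprint_weight de dX ab)%N.
Proof.
case: ab => a b eta1 abK; have dE := deltaE.
rewrite /footprint_weight /= muln_gt0.
have := sub_Kstar abK; rewrite mem_K_set in_KP => /and3P[aA eab bq].
apply/andP; split; last by move: bq; case: eqP; lia.
case: (ltnP a q) => [|qa]; first lia.
move: aA; rewrite /in_AX; case: ifP => [|/negbT]; first by lia.
rewrite -ltNge => dT0; have eta0 : (1 < eta)%N by lia.
case: (ltnP a q) => [|_]; first lia.
have -> : (a <= minn (de %/ eta) q.-1)%N = false by lia.
case/andP => dvd /eqP aE; move: (dvd) => /divnK; rewrite -aE => deE.
have H : condH q eta dT dX.
  rewrite /condH eta0 dT0 /=.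
  have dTE : dT = (a%:Z - dX%:Z) * eta%:Z by lia.
  by rewrite dTE dvdz_mull //= mulzK; lia.
move: abK; rewrite /Kstar H mem_filter -aE; case: eqP => //= ab0 _.
by case: ab0; congr pair; lia.
Qed.

End Box.

(** * Multiples of a monomial *)

Section Divisibility.

Variables (dT : int) (dX eT eX : nat).
Hypothesis delta_ge0 : 0 <= dT + (eta * dX)%:Z.
Hypothesis q_gt0 : (0 < q)%N.
Hypothesis eX_ge : (q <= eX)%N.

Local Notation de := (deltan eta dT dX).
Local Notation dee := (eT + eta * eX)%N.

Lemma deltan_nat : deltan eta eT%:Z eX = dee.
Proof. by rewrite /deltan /delta -PoszD. Qed.

Lemma Kstar_nat : Kstar q eta eT%:Z eX = K_set q eta eT%:Z eX.
Proof. by rewrite /Kstar /condH andbF. Qed.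

Definition multiples (ab : nat * nat) : seq (nat * nat) :=
  [seq cd <- Kstar q eta eT%:Z eX |
     mdivides (Mmono eta dT dX ab) (Mmono eta eT%:Z eX cd)].

Lemma divcountE ab :
  divcount q eta eT%:Z eX (Mmono eta dT dX ab) = size (multiples ab).
Proof.
rewrite /divcount /Deltastar undup_id ?count_map ?size_filter //.
by rewrite map_inj_uniq ?uniq_Kstar // => -[? ?] [? ?] [_ -> _ ->].
Qed.

Lemma mem_multiples a b c d : (a <= dX)%N -> (eta * a + b <= de)%N ->
  ((c, d) \in multiples (a, b)) =
  [&& (c < q)%N || (c == eX), (c <= eX)%N, (eta * c + d <= dee)%N,
      (d < q)%N || (eta * c + d == dee),
      (a <= c)%N, (b <= d)%N, (dX - a <= eX - c)%N &
      (de - eta * a - b <= dee - eta * c - d)%N].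
Proof.
move=> aX eab.
rewrite mem_filter Kstar_nat mem_K_set // in_KP // /in_AX deltan_nat /=.
by rewrite deltan_nat; apply/idP/idP; lia.
Qed.

(** If c = eX, then X1 does not occur in N, so M(a, b) can divide N only if a = dX. Likewise d = dee
    - eta c leaves no T1 and forces eta a + b = de. Each [nseq] holds this extra value once or not
    at all. *)
Definition multiples_box (ab : nat * nat) : seq (nat * nat) :=
  [seq (c, d) | c <- iota ab.1 (q - ab.1) ++ nseq (ab.1 == dX) eX,
                d <- iota ab.2 (q - ab.2)
                     ++ nseq (eta * ab.1 + ab.2 == de) (dee - eta * c)%N].

Lemma size_multiples_box ab :
  size (multiples_box ab) = footprint_weight de dX ab.
Proof.
rewrite size_allpairs_dep /footprint_weight.
set n := (q - ab.2 + _)%N.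
rewrite sumnE big_map (eq_bigr (fun=> n)) => [|c _]; last first.
  by rewrite size_cat size_iota size_nseq.
rewrite big_const_seq count_predT iter_addn_0 size_cat size_iota size_nseq.
by rewrite mulnC.
Qed.

Lemma mem_multiples_box a b c d : ((c, d) \in multiples_box (a, b)) =
  ((a <= c < q)%N || (a == dX) && (c == eX)) &&
  ((b <= d < q)%N || (eta * a + b == de) && (d == dee - eta * c)%N).
Proof.
have mem_end x n (B : bool) y :
    (y \in iota x (q - x) ++ nseq B n) = (x <= y < q)%N || B && (y == n).
  rewrite mem_cat mem_iota mem_nseq; case: B => /=; lia.
apply/allpairsPdep/idP => [[c' [d' []]]|/andP[]] /=.
  by rewrite !mem_end => h1 h2 [-> ->]; rewrite h1.
by move=> h1 h2; exists c, d; rewrite !mem_end.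
Qed.

Lemma divcount_le a b : (a, b) \in Kstar q eta dT dX ->
  (divcount q eta eT%:Z eX (Mmono eta dT dX (a, b))
   <= footprint_weight de dX (a, b))%N.
Proof.
move=> abK; have [aX eab] := Kstar_box delta_ge0 q_gt0 abK.
rewrite divcountE -size_multiples_box; apply: uniq_leq_size.
  by apply: filter_uniq; apply: uniq_Kstar.
by move=> [c d]; rewrite mem_multiples // mem_multiples_box; lia.
Qed.

(** For c < q the exponent of X1 in N is at least dX, and for d < q that of T1 is at least de, so
    the whole box consists of multiples. It has no repetition because eX and dee - eta c are at
    least q. *)
Lemma divcount_eq a b : (a, b) \in Kstar q eta dT dX ->
  (dX + q <= eX)%N -> (de + q <= eT)%N ->
  divcount q eta eT%:Z eX (Mmono eta dT dX (a, b))
  = footprint_weight de dX (a, b).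
Proof.
move=> abK hX hT; apply/eqP; rewrite eqn_leq divcount_le // andTb.
have [aX eab] := Kstar_box delta_ge0 q_gt0 abK.
rewrite divcountE -size_multiples_box; apply: uniq_leq_size.
  have uniq_end x n (B : bool) : (q <= n)%N ->
      uniq (iota x (q - x) ++ nseq B n).
    move=> qn; rewrite cat_uniq iota_uniq; case: B => //=.
    by rewrite mem_iota; lia.
  apply: allpairs_uniq_dep => [|c|[c d] [c' d'] _ _ [<- <-]] //=.
    exact: uniq_end.
  rewrite mem_cat mem_iota mem_nseq => cX; apply: uniq_end.
  have /(leq_mul (leqnn eta)) : (c <= eX)%N by case: eqP cX; lia.
  lia.
move=> [c d]; rewrite mem_multiples // mem_multiples_box.
case/andP=> cP; have cX : (c <= eX)%N by lia.
by have := leq_mul (leqnn eta) cX; case: (eqVneq c eX) cP => [->|]; lia.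
Qed.

End Divisibility.
End Combinatorics.

(** * Functions on P^1(F_q), with [None] as the point at infinity *)

Lemma card_option_set (T : finType) (P : pred (option T)) :
  #|[set t | P t]| = (#|[set x | P (Some x)]| + P None)%N.
Proof.
rewrite (cardsD1 None) inE addnC; congr (_ + _)%N.
rewrite -[RHS](card_imset _ (@Some_inj _)).
apply: eq_card => -[x|]; rewrite !inE /=.
  by rewrite mem_imset ?inE //; apply: (@Some_inj _).
by symmetry; apply/imsetP => -[].
Qed.

Section BinaryForms.

Variable F : finFieldType.
Implicit Types (p : {poly F}) (e : nat) (g : option F -> F).
Variable q : nat.
Hypothesis cardF : #|F| = q.

Lemma cardF_gt1 : (1 < q)%N.
Proof. by rewrite -cardF; apply: finNzRing_gt1. Qed.

Lemma card_nonroots p n : p != 0 -> (size p <= n.+1)%N ->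
  (q - n <= #|[set x | p.[x] != 0%R]|)%N.
Proof.
move=> p0 sp; set s := [set x | root p x].
have : (size (enum s) < size p)%N.
  apply: max_poly_roots p0 _ (enum_uniq _).
  by apply/allP => x; rewrite mem_enum inE.
rewrite -cardE => sz; have -> : [set x | p.[x] != 0] = ~: s.
  by apply/setP => x; rewrite !inE.
by rewrite -cardF -(cardsC s) leq_subLR leq_add2r -ltnS (leq_trans sz).
Qed.

(* The form sum_(c <= e) p`_c T1^(e-c) T2^c at the points (1, t) and (0, 1). *)
Definition form_value e p (t : option F) : F :=
  if t is Some a then p.[a] else p`_e.

(** A property of the function on rational points only, so that one function may be a form of
    several degrees. *)
Definition is_form e g : Prop :=
  exists2 p : {poly F}, (size p <= e.+1)%N & g =1 form_value e p.

Lemma is_form_sum e (I : Type) (r : seq I) (P : pred I) (g : I -> option F -> F) :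
  (forall i, P i -> is_form e (g i)) ->
  is_form e (fun t => \sum_(i <- r | P i) g i t).
Proof.
move=> gP; elim: r => [|i r [p sp pE]].
  by exists 0 => [|[a|]]; rewrite ?size_poly0 // big_nil /= ?horner0 ?coef0.
case Pi: (P i); last by exists p => // t; rewrite big_cons Pi.
have [p' sp' pE'] := gP i Pi; exists (p' + p) => [|t].
  by rewrite (leq_trans (size_polyD _ _)) // geq_max sp'.
by rewrite big_cons Pi pE pE'; case: t => [a|] /=; rewrite ?hornerD ?coefD.
Qed.

Lemma expf_card_pred (x : F) : x ^+ q.-1 = (x != 0)%:R.
Proof.
have q1 := cardF_gt1.
case: eqVneq => [->|x0]; first by rewrite expr0n; case: eqP => //; lia.
apply: (mulfI x0); rewrite -exprS prednK ?mulr1 -?cardF ?expf_card //; lia.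
Qed.

(* Interpolation at F with the basis 1 - (X - a)^(q-1) of size q <= e. *)
Lemma is_form_all e g : (q <= e)%N -> is_form e g.
Proof.
move=> qe; have q1 := cardF_gt1.
pose l (a : F) : {poly F} := 1 - ('X - a%:P) ^+ q.-1.
have sl a : (size (l a) <= e)%N.
  rewrite (leq_trans (size_polyD _ _)) // geq_max size_poly1 size_polyN.
  by rewrite size_exp_XsubC; lia.
have le a b : (l a).[b] = (b == a)%:R.
  rewrite !hornerE expf_card_pred subr_eq0; case: eqP => _; rewrite ?subr0 //.
  by rewrite subrr.
(* The subtracted term compensates for g None X^e, which is added below to produce the value at
   infinity. *)
pose s := \sum_a (g (Some a) - g None * a ^+ e) *: l a.
have ss : (size s <= e)%N.
  apply: leq_trans (size_sum _ _ _) _; apply/bigmax_leqP => a _.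
  by apply: leq_trans (size_scale_leq _ _) (sl a).
exists (s + g None *: 'X^e) => [|[b|]] /=.
- rewrite (leq_trans (size_polyD _ _)) // geq_max (leqW ss).
  by rewrite (leq_trans (size_scale_leq _ _)) // size_polyXn.
- rewrite hornerD hornerZ hornerXn horner_sum (bigD1 b) //= hornerZ le eqxx mulr1.
  rewrite big1 ?addr0 ?subrK // => a ab.
  by rewrite hornerZ le eq_sym (negPf ab) mulr0.
- by rewrite coefD coefZ coefXn eqxx mulr1 nth_default ?add0r.
Qed.

Lemma is_form_widen e e' g : (e = e' \/ q <= e')%N -> is_form e g -> is_form e' g.
Proof. by case=> [->|/is_form_all]. Qed.

(** If the coefficient of degree e is nonzero, infinity counts and b = e. Otherwise the form
    vanishes at infinity and b is the degree of p, capped at q - 1. *)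
Lemma is_form_support e g : is_form e g -> (exists t, g t != 0) ->
  exists b, [/\ (b <= e)%N, (b < q)%N || (b == e) &
                (q - b + (b == e) <= #|[set t | g t != 0%R]|)%N].
Proof.
case=> p sp gE [t0]; have q1 := cardF_gt1.
have -> : [set t | g t != 0] = [set t | form_value e p t != 0].
  by apply/setP => t; rewrite !inE gE.
rewrite gE (card_option_set (fun t => form_value e p t != 0)) /= => pt0.
have p0 : p != 0.
  by apply: contraNneq pt0 => ->; case: t0 => [a|] /=; rewrite ?horner0 ?coef0.
have [pe|pe] := eqVneq p`_e 0; last first.
  exists e; rewrite leqnn eqxx orbT; split=> //.
  by rewrite leq_add2r card_nonroots.
have sp1 : (size p <= e)%N.
  rewrite leqNgt; apply/negP => lt; have szE : (size p).-1 = e by lia.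
  by move: p0; rewrite -lead_coef_eq0 lead_coefE szE pe eqxx.
case: t0 pt0 => [a /= pa|]; last by rewrite /= pe eqxx.
have sp0 : (0 < size p)%N by rewrite size_poly_gt0.
(* When deg p >= q, counting roots gives nothing, but the nonroot a supplies the one value that b =
   q - 1 requires. *)
exists (minn (size p).-1 q.-1).
have -> : (minn (size p).-1 q.-1 == e) = false by lia.
split; [lia|lia|rewrite addn0].
have := card_nonroots p0 (leqSpred _); set N := #|_|.
have : (0 < N)%N by apply/card_gt0P; exists a; rewrite inE.
lia.
Qed.

End BinaryForms.

(** * The footprint lower bound for weights *)

Section LowerBound.

Variables (F : finFieldType) (q eta : nat) (dT : int) (dX : nat).
Hypothesis cardF : #|F| = q.
Hypothesis eta_neq1 : eta != 1%N.
Hypothesis delta_ge0 : 0 <= dT + (eta * dX)%:Z.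

Local Notation de := (deltan eta dT dX).

(** The exponent of x^d modulo x^q - x. The shift by one keeps positive exponents positive, as the
    value at x = 0 demands. *)
Definition reduced_exp (d : nat) : nat :=
  if (d < q)%N then d else ((d - 1) %% q.-1).+1.

Lemma reduced_expE (x : F) d : x ^+ reduced_exp d = x ^+ d.
Proof.
rewrite /reduced_exp; case: ltnP => // qd; have q1 := cardF_gt1 cardF.
have xq : x * x ^+ q.-1 = x.
  by rewrite -exprS prednK; [rewrite -cardF expf_card | lia].
have per r k : x ^+ (k * q.-1 + r).+1 = x ^+ r.+1.
  elim: k => // k IH; rewrite mulSn -addnA -addnS exprD IH exprS mulrCA.
  by rewrite mulrA xq.
rewrite -[in RHS](subnK (ltnW (leq_trans q1 qd))) {2}(divn_eq (d - 1) q.-1).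
by rewrite addn1 per.
Qed.

Lemma reduced_exp_lt d : (reduced_exp d < q)%N.
Proof.
have q1 := cardF_gt1 cardF; rewrite /reduced_exp; case: (ltnP d q) => //= _.
by rewrite -ltn_predRL ltn_pmod //; lia.
Qed.

Lemma reduced_exp_cases d :
  reduced_exp d = d \/ (reduced_exp d + q.-1 <= d)%N.
Proof.
rewrite /reduced_exp; case: ltnP => qd; [by left | right].
have q1 := cardF_gt1 cardF; have := divn_eq (d - 1) q.-1.
have : (0 < (d - 1) %/ q.-1)%N by rewrite divn_gt0; lia.
set k := (_ %/ _)%N; set r := (_ %% _)%N => k0.
by have := leq_mul k0 (leqnn q.-1); lia.
Qed.

Lemma weight_fibres (f : Pt F -> F) (h : option F -> F) m n :
  (forall t, h t != 0 -> (m <= #|[set x | f (t, x) != 0%R]|)%N) ->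
  (n <= #|[set t | h t != 0%R]|)%N ->
  (m * n <= #|[set P | f P != 0%R]|)%N.
Proof.
move=> hm hn; rewrite (card_pairs (fun P => f P != 0)) mulnC.
apply: leq_trans (leq_mul hn (leqnn m)) _.
rewrite -sum_nat_const [leqRHS](bigID (mem [set t | h t != 0])) /=.
by apply: leq_trans (leq_addr _ _); apply: leq_sum => t; rewrite inE; apply: hm.
Qed.

Variable g : nat -> option F -> F.
Hypothesis g_form : forall d, (eta * d <= de)%N -> is_form (de - eta * d) (g d).
Hypothesis g_out : forall d, (de < eta * d)%N -> g d =1 fun=> 0.

Lemma g_support d t : g d t != 0 -> (eta * d <= de)%N.
Proof. by apply: contraNT; rewrite -ltnNge => /g_out ->. Qed.

(* A form of degree >= q takes arbitrary values on P^1(F_q), so reducing the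
   exponent d stays within forms of degree de - eta * a, except possibly when
   eta = 1: then de - eta * a can be as small as q - 1. *)
Lemma reduced_coef_form n a : (eta * a <= de)%N ->
  is_form (de - eta * a)
          (fun t => \sum_(d < n | reduced_exp d == a) g d t).
Proof.
move=> ea; apply: (@is_form_sum F _ 'I_n _ _ (fun d => g d)) => d /eqP da.
have q1 := cardF_gt1 cardF.
case: (leqP (eta * d) de) => [ed|/g_out g0]; last first.
  exists 0; first by rewrite size_poly0.
  by case=> [x|]; rewrite g0 /= ?horner0 ?coef0.
apply: is_form_widen (g_form ed) => //.
have := reduced_exp_cases d; rewrite da => -[->|le]; first by left.
have [eta0|eta2] : eta = 0%N \/ (2 <= eta)%N by lia.
  by rewrite eta0; left.
(* Here d - a >= q - 1, so de - eta a >= eta (d - a) >= 2 (q - 1) >= q. *)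
right; have := leq_mul (leqnn eta) le; rewrite mulnDr.
by have := leq_mul eta2 (leqnn q.-1); lia.
Qed.

Variable f : Pt F -> F.
Hypothesis f_some : forall t x, f (t, Some x) = \sum_(d < dX.+1) g d t * x ^+ d.
Hypothesis f_none : forall t, f (t, None) = g dX t.

Lemma weight_ge_footprint : (exists P, f P != 0) ->
  exists2 ab, ab \in Kstar q eta dT dX &
    (footprint_weight q eta de dX ab <= #|[set P | f P != 0%R]|)%N.
Proof.
move=> [[t0 x0] f0]; have q1 := cardF_gt1 cardF; have dE := deltaE delta_ge0.
have q0 := ltnW q1.
have [/existsP[t1 gt1]|] := boolP [exists t, g dX t != 0].
  (* The form g dX has degree de - eta dX = dT; being nonzero, it forces dT >= 0, whence (dX, b)
     lies in K^*. *)
  have eX := g_support gt1.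
  have [b [be bq cb]] := is_form_support cardF (g_form eX) (ex_intro _ t1 gt1).
  exists (dX, b).
    by apply: Kstar_top => //; lia.
  rewrite /footprint_weight /= eqxx.
  have -> : (eta * dX + b == de)%N = (b == de - eta * dX)%N by lia.
  apply: weight_fibres cb => t gt.
  rewrite (card_option_set (fun x => f (t, x) != 0)) f_none gt leq_add2r.
  pose p := \poly_(d < dX.+1) g d t.
  have pX : p`_dX = g dX t by rewrite coef_poly ltnSn.
  have p0 : p != 0 by apply: contraNneq gt => p0; rewrite -pX p0 coef0.
  apply: leq_trans (card_nonroots cardF p0 (size_poly _ _)) _.
  apply: eq_leq; apply: eq_card => x.
  by rewrite !inE f_some horner_poly.
rewrite negb_exists => /forallP g0.
have {}g0 t : g dX t = 0 by have := g0 t; rewrite negbK => /eqP.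
(* The term d = dX is dropped, since g dX now vanishes identically. *)
pose h a t := \sum_(d < dX | reduced_exp d == a) g d t.
have fE t x : f (t, Some x) = \sum_(a < q) h a t * x ^+ a.
  rewrite f_some big_ord_recr /= g0 mul0r addr0.
  rewrite (partition_big (fun d : 'I_dX => Ordinal (reduced_exp_lt d)) xpredT) //=.
  apply: eq_bigr => a _; rewrite /h mulr_suml; apply: eq_big => d.
    by rewrite -val_eqE.
  by move=> /eqP <- /=; rewrite reduced_expE.
pose P (a : 'I_q) := [exists t, h a t != 0].
have [a0 Pa0] : exists a, P a.
  case: x0 f0 => [x|]; last by rewrite f_none g0 eqxx.
  rewrite fE => sn0; apply/existsP; apply: contraNT sn0.
  rewrite negb_exists => /forallP nP; rewrite big1 // => a _.
  have := nP a; rewrite negb_exists => /forallP/(_ t0).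
  by rewrite negbK => /eqP ->; rewrite mul0r.
case: (arg_maxnP (fun a : 'I_q => a : nat) Pa0) => a /existsP[t1 ht1] amax.
(* A nonzero h a comes from some unreduced exponent d >= a with g d nonzero; this d yields both eta
   a <= eta d <= de and a <= d < dX. *)
have [d da gd] : exists2 d : 'I_dX, reduced_exp d = a & g d t1 != 0.
  have [/existsP[d /andP[/eqP da gd]]|] :=
    boolP [exists d : 'I_dX, (reduced_exp d == a) && (g d t1 != 0)].
    by exists d.
  rewrite negb_exists => /forallP n0; move: ht1; rewrite /h big1 ?eqxx // => d da.
  by have := n0 d; rewrite da negbK => /eqP.
have ad : (a <= d)%N by have := reduced_exp_cases d; lia.
have ea : (eta * a <= de)%N.
  by apply: leq_trans (g_support gd); rewrite leq_mul2l ad orbT.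
have aX : (a < dX)%N by apply: leq_ltn_trans ad (ltn_ord d).
have [b [be bq cb]] :=
  is_form_support cardF (@reduced_coef_form dX a ea) (ex_intro _ t1 ht1).
exists (nat_of_ord a, b).
  by apply: Kstar_small => //; lia.
rewrite /footprint_weight /= (ltn_eqF aX) addn0.
have -> : (eta * a + b == de)%N = (b == de - eta * a)%N by lia.
apply: weight_fibres cb => t ht.
rewrite (card_option_set (fun x => f (t, x) != 0)) f_none g0 eqxx addn0.
pose p := \poly_(d < q) h d t.
have pa : p`_a = h a t by rewrite coef_poly ltn_ord.
have p0 : p != 0 by apply: contraNneq ht => p0; rewrite -/(h a t) -pa p0 coef0.
(* Maximality of a was taken over all fibres at once, so the coefficients above a vanish on the
   fibre of t as well. *)
have sp : (size p <= a.+1)%N.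
  apply/leq_sizeP => i ai; rewrite coef_poly; case: ltnP => // iq.
  apply/eqP; apply: contraTT ai => hi; rewrite -leqNgt.
  by apply: (amax (Ordinal iq)); apply/existsP; exists t.
apply: leq_trans (card_nonroots cardF p0 sp) _.
by apply: eq_leq; apply: eq_card => x; rewrite !inE fE horner_poly.
Qed.

End LowerBound.

(** * Polynomials of given bidegree as families of binary forms *)

Section Evaluation.

Variables (F : finFieldType) (eta : nat).

Lemma val_ix k : (k < 4)%N -> ix k = k :> nat.
Proof. exact: inordK. Qed.

Lemma prod_ix (R : comPzRingType) (E : 'I_4 -> R) :
  \prod_i E i = E (ix 0) * E (ix 1) * E (ix 2) * E (ix 3).
Proof.
rewrite !big_ord_recr big_ord0 /= mul1r; congr (E _ * E _ * E _ * E _);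
by apply: val_inj; rewrite /= val_ix.
Qed.

Definition affine_coords (t : option F) : F * F :=
  if t is Some a then (1, a) else (0, 1).

Lemma coords_ix (P : Pt F) :
  [/\ coords P (ix 0) = (affine_coords P.1).1,
      coords P (ix 1) = (affine_coords P.1).2,
      coords P (ix 2) = (affine_coords P.2).1 &
      coords P (ix 3) = (affine_coords P.2).2].
Proof.
by case: P => [[a|] [b|]]; rewrite /coords /= !val_ix.
Qed.

Section Decomposition.

Variables (dT : int) (dX : nat).
Hypothesis delta_ge0 : 0 <= dT + (eta * dX)%:Z.
Variable p : {mpoly F[4]}.
Hypothesis pR : in_R eta dT dX p.

Local Notation de := (deltan eta dT dX).

(** The coefficient of X2^d after setting T1 = X1 = 1; the bidegree determines the exponents thus
    forgotten. *)
Definition X2_coef (d : nat) : {poly F} :=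
  \sum_(m <- msupp p | m (ix 3) == d) p@_m *: 'X^(m (ix 1)).

Definition X2_value (d : nat) : option F -> F :=
  form_value (de - eta * d) (X2_coef d).

(** Substituting dX - m3 for the exponent of X1 turns the degree in T1, T2 into de - eta m3. *)
Lemma bideg_supp m : m \in msupp p ->
  (m (ix 2) + m (ix 3) = dX)%N /\
  (m (ix 0) + m (ix 1) + eta * m (ix 3) = de)%N.
Proof.
move=> /pR []; have := deltaE delta_ge0 => dE eT eX; split=> //.
have eeX : (eta * m (ix 2) + eta * m (ix 3) = eta * dX)%N by rewrite -mulnDr eX.
lia.
Qed.

Lemma X2_value_form d : (eta * d <= de)%N -> is_form (de - eta * d) (X2_value d).
Proof.
move=> ed; exists (X2_coef d) => //.
apply: (leq_trans (size_sum _ _ _)); apply/bigmax_leqP_seq => m mp /eqP mD.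
rewrite (leq_trans (size_scale_leq _ _)) // size_polyXn.
by have [_] := bideg_supp mp; rewrite mD; lia.
Qed.

Lemma X2_value_out d : (de < eta * d)%N -> X2_value d =1 fun=> 0.
Proof.
move=> ed t; rewrite /X2_value /X2_coef big_seq_cond big_pred0.
  by case: t => [a|] /=; rewrite ?horner0 ?coef0.
move=> m; apply/negbTE/negP => /andP[/bideg_supp[_ mE] /eqP mD]; move: mE.
by rewrite mD; lia.
Qed.

Lemma form_value_sum e (I : Type) (r : seq I) (P : pred I) (c : I -> F) k t :
  form_value e (\sum_(i <- r | P i) c i *: 'X^(k i)) t =
  \sum_(i <- r | P i) c i * form_value e 'X^(k i) t.
Proof.
case: t => [a|] /=; rewrite ?horner_sum ?coef_sum; apply: eq_bigr => i _.
  by rewrite hornerZ.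
by rewrite coefZ.
Qed.

Lemma monomial_T_value m t : m \in msupp p ->
  (affine_coords t).1 ^+ m (ix 0) * (affine_coords t).2 ^+ m (ix 1) =
  form_value (de - eta * m (ix 3)) 'X^(m (ix 1)) t.
Proof.
move=> /bideg_supp[_ mE]; case: t => [a|] /=.
  by rewrite expr1n mul1r hornerXn.
(* At (0, 1) the power of T1 is 1 if its exponent is 0 and vanishes otherwise; the exponent is 0
   exactly when T2 carries the full degree de - eta m3. *)
rewrite expr1n mulr1 coefXn expr0n; congr (_%:R); congr nat_of_bool; lia.
Qed.

Lemma meval_affine t x :
  p.@[coords (t, Some x)] = \sum_(d < dX.+1) X2_value d t * x ^+ d.
Proof.
rewrite mevalE.
under [RHS]eq_bigr => d _ do rewrite /X2_value form_value_sum mulr_suml.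
rewrite (exchange_big_dep xpredT) //=; apply: eq_big_seq => m mp.
have [mX _] := bideg_supp mp.
have m3 : (m (ix 3) < dX.+1)%N by lia.
rewrite (big_pred1 (Ordinal m3)) /=; last by move=> d; apply: eq_sym.
have [e0 e1 e2 e3] := coords_ix (t, Some x).
by rewrite prod_ix e0 e1 e2 e3 /= expr1n mulr1 monomial_T_value // mulrA.
Qed.

Lemma meval_infinity t : p.@[coords (t, None)] = X2_value dX t.
Proof.
rewrite mevalE /X2_value form_value_sum [RHS]big_mkcond.
apply: eq_big_seq => m mp.
have [mX _] := bideg_supp mp.
have [e0 e1 e2 e3] := coords_ix (t, None).
rewrite prod_ix e0 e1 e2 e3 /= expr1n mulr1 monomial_T_value // expr0n.
have -> : (m (ix 2) == 0)%N = (m (ix 3) == dX) by lia.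
by case: eqP => [->|_]; rewrite ?mulr1 ?mulr0.
Qed.

End Decomposition.

(** * Bidegrees of sums and products *)

Section Homogeneous.

Implicit Types (a b : int) (c d : nat) (p : {mpoly F[4]}).

Lemma in_RB a c p p' : in_R eta a c p -> in_R eta a c p' -> in_R eta a c (p - p').
Proof.
by move=> pR pR' m /msuppB_le; rewrite mem_cat => /orP[/pR | /pR'].
Qed.

Lemma in_RM a b c d p p' :
  in_R eta a c p -> in_R eta b d p' -> in_R eta (a + b) (c + d)%N (p * p').
Proof.
move=> pR pR' m /msuppM_le/allpairsP[[m1 m2] /= [/pR[<- <-] /pR'[<- <-] ->]].
by rewrite /bideg !mnmDE; congr pair; lia.
Qed.

Lemma in_R1 : in_R eta 0 0 (1 : {mpoly F[4]}).
Proof.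
by move=> m; rewrite msupp1 inE => /eqP ->; rewrite /bideg !mnm0E muln0.
Qed.

Lemma in_RZ a c s p : in_R eta a c p -> in_R eta a c (s *: p).
Proof. by move=> pR m /msuppZ_le /pR. Qed.

Lemma in_R_prod a c n (p : 'I_n -> {mpoly F[4]}) :
  (forall i, in_R eta a c (p i)) -> in_R eta (a *+ n) (c * n)%N (\prod_i p i).
Proof.
elim: n p => [|n IH] p pR; first by rewrite big_ord0 muln0; apply: in_R1.
rewrite big_ord_recl mulrS mulnS; apply: in_RM (pR _) _; exact: IH.
Qed.

Lemma in_RXn a c p n : in_R eta a c p -> in_R eta (a *+ n) (c * n)%N (p ^+ n).
Proof.
move=> pR; elim: n => [|n IH]; first by rewrite muln0; apply: in_R1.
by rewrite exprS mulrS mulnS; apply: in_RM.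
Qed.

Lemma in_R_var (i : 'I_4) : in_R eta
  ((i == ix 0)%:Z + (i == ix 1)%:Z - (eta * (i == ix 2))%:Z)
  ((i == ix 2) + (i == ix 3))%N ('X_i : {mpoly F[4]}).
Proof. by move=> m; rewrite msuppX inE => /eqP ->; rewrite /bideg !mnm1E. Qed.

Lemma ix_eq j k : (j < 4)%N -> (k < 4)%N -> (ix j == ix k) = (j == k).
Proof. by move=> j4 k4; rewrite -val_eqE /= !val_ix. Qed.

Lemma in_R_T1 : in_R eta 1 0 ('X_(ix 0) : {mpoly F[4]}).
Proof. by have := @in_R_var (ix 0); rewrite !ix_eq //= muln0. Qed.

Lemma in_R_T2 : in_R eta 1 0 ('X_(ix 1) : {mpoly F[4]}).
Proof. by have := @in_R_var (ix 1); rewrite !ix_eq //= muln0. Qed.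

Lemma in_R_X1 : in_R eta (- eta%:Z) 1 ('X_(ix 2) : {mpoly F[4]}).
Proof. by have := @in_R_var (ix 2); rewrite !ix_eq //= muln1 add0r. Qed.

Lemma in_R_X2 : in_R eta 0 1 ('X_(ix 3) : {mpoly F[4]}).
Proof. by have := @in_R_var (ix 3); rewrite !ix_eq //= muln0. Qed.

End Homogeneous.
End Evaluation.

(** * Words attaining the footprint weights *)

Section MinimalWord.

Variables (F : finFieldType) (q eta : nat) (dT : int) (dX : nat).
Hypothesis cardF : #|F| = q.
Hypothesis eta_neq1 : eta != 1%N.
Hypothesis delta_ge0 : 0 <= dT + (eta * dX)%:Z.

Local Notation de := (deltan eta dT dX).

(* For eta >= 2, x^eta - x^(eta-1) takes the value 0 at both 0 and 1, hence
   misses some c, and T2^eta - T1 T2^(eta-1) - c T1^eta has no rational zero. *)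
Lemma rootless_form : exists (H : {mpoly F[4]}) (h : option F -> F),
  [/\ in_R eta eta%:Z 0 H, forall t x, H.@[coords (t, x)] = h t &
      forall t, h t != 0].
Proof.
have [eta0|eta2] : eta = 0%N \/ (2 <= eta)%N by lia.
  exists 1, (fun=> 1); split=> [|t x|t]; rewrite ?meval1 ?oner_eq0 //.
  by rewrite eta0; apply: in_R1.
pose phi (x : F) := x ^+ eta - x ^+ eta.-1.
have phi01 : phi 0 = phi 1.
  rewrite /phi !expr1n subrr !expr0n.
  have -> : (eta == 0%N) = false by lia.
  by have -> : (eta.-1 == 0%N) = false by [lia]; rewrite subrr.
have /existsP[c cP] : [exists c, c \notin codom phi].
  (* A surjective map of a finite set to itself is injective, which phi 0 = phi 1 contradicts. *)
  rewrite -negb_forall; apply/negP => /forallP surj.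
  have /image_injP inj : #|image phi F| == #|F|.
    by apply/eqP/eq_card => x; rewrite surj inE.
  by have /eqP := inj 0 1 isT isT phi01; rewrite eq_sym oner_eq0.
pose T1 : {mpoly F[4]} := 'X_(ix 0); pose T2 : {mpoly F[4]} := 'X_(ix 1).
exists (T2 ^+ eta - T1 * T2 ^+ eta.-1 - c *: T1 ^+ eta).
exists (fun t => if t is Some x then phi x - c else 1); split=> [|t x|[x|]] /=.
- have eE : eta%:Z = 1 + 1 *+ eta.-1 :> int by rewrite -mulrS prednK //; lia.
  apply: in_RB; first apply: in_RB.
  + by have := in_RXn (n := eta) (@in_R_T2 F eta); rewrite natz.
  + have := in_RM (@in_R_T1 F eta) (in_RXn (n := eta.-1) (@in_R_T2 F eta)).
    by rewrite -eE.
  + by apply: in_RZ; have := in_RXn (n := eta) (@in_R_T1 F eta); rewrite natz.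
- have [e0 e1 _ _] := coords_ix (t, x).
  rewrite !mevalB mevalZ mevalM !rmorphXn /= !mevalXU e0 e1.
  case: t {e0 e1} => [y|] /=; first by rewrite expr1n mul1r mulr1.
  by rewrite expr1n expr0n mul0r (_ : (eta == 0%N) = false) ?mulr0 ?subr0 //; lia.
- by rewrite subr_eq0; apply: contraNneq cP => <-; apply: codom_f.
- exact: oner_neq0.
Qed.

(** The roots are h times the first n elements of F. For n > q the extra factors use the default 0,
    and all of F is already covered. *)
Lemma card_nonroots_translates n (h : F) : h != 0 ->
  #|[set x | \prod_(i < n) (x - (enum F)`_i * h) != 0]| = (q - n)%N.
Proof.
move=> h0; set s := enum F.
have rootE x : (\prod_(i < n) (x - s`_i * h) == 0) = (x / h \in take n s).
  have sx : x / h \in s by rewrite mem_enum.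
  rewrite in_take //; apply/prodf_eq0/idP => [[i _]|lt_n].
    rewrite subr_eq0 => /eqP ->; rewrite mulfK //.
    have [iq|qi] := ltnP i (size s); first by rewrite index_uniq ?enum_uniq.
    by rewrite (leq_ltn_trans _ (ltn_ord i)) // (leq_trans (index_size _ _)).
  by exists (Ordinal lt_n) => //=; rewrite nth_index // divfK // subrr.
have -> : [set x | \prod_(i < n) (x - s`_i * h) != 0] =
          [set y * h | y in [predC take n s]].
  apply/setP => x; rewrite inE rootE; apply/idP/imsetP => [xh|[y ys ->]].
    by exists (x / h); rewrite ?inE ?divfK.
  by rewrite mulfK.
rewrite card_imset; last exact: mulIf.
have sE : size s = q by rewrite -cardF cardE.
have /card_uniqP nE : uniq (take n s) by apply/take_uniq/enum_uniq.
have : (size (take n s) + #|[predC take n s]|)%N = q by rewrite -nE cardC cardF.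
rewrite size_take sE; set N := #|_|; case: ltnP => ?; lia.
Qed.

Variables a b : nat.
Hypothesis a_le : (a <= dX)%N.
Hypothesis ab_le : (eta * a + b <= de)%N.

(** The factors in T have b prescribed roots. Since H has no rational zero, those in X have min(a,
    q) distinct roots on every fibre, so the weight is a product. The powers of T1 and X1 decide the
    values at the points at infinity. *)
Lemma footprint_word : exists2 p : {mpoly F[4]}, in_R eta dT dX p &
  #|[set P | p.@[coords P] != 0]| = footprint_weight q eta de dX (a, b).
Proof.
have [H [h [HR hE h0]]] := rootless_form.
pose T1 : {mpoly F[4]} := 'X_(ix 0); pose T2 : {mpoly F[4]} := 'X_(ix 1).
pose X1 : {mpoly F[4]} := 'X_(ix 2); pose X2 : {mpoly F[4]} := 'X_(ix 3).
(* Multiplying X1 by H gives it the bidegree (0, 1) of X2, so that their linear combinations are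
   bihomogeneous. *)
pose pX := X1 ^+ (dX - a) * \prod_(i < a) (X2 - (enum F)`_i *: (X1 * H)).
pose pT := T1 ^+ (de - eta * a - b) * \prod_(j < b) (T2 - (enum F)`_j *: T1).
exists (pX * pT).
  have XR : in_R eta 0 1 (X1 * H).
    by have := in_RM (@in_R_X1 F eta) HR; rewrite addNr.
  have pXR : in_R eta (- eta%:Z *+ (dX - a)) dX pX.
    have := in_RM (in_RXn (n := (dX - a)) (@in_R_X1 F eta))
      (in_R_prod (fun i : 'I_a =>
        in_RB (@in_R_X2 F eta) (in_RZ (s := (enum F)`_i) XR))).
    by rewrite mul0rn addr0 !mul1n subnK.
  have pTR : in_R eta (de - eta * a)%N%:Z 0 pT.
    have := in_RM (in_RXn (n := (de - eta * a - b)) (@in_R_T1 F eta))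
      (in_R_prod (fun j : 'I_b =>
        in_RB (@in_R_T2 F eta) (in_RZ (s := (enum F)`_j) (@in_R_T1 F eta)))).
    by rewrite !natz -PoszD subnK //; lia.
  have := in_RM pXR pTR; rewrite addn0.
  suff -> : - eta%:Z *+ (dX - a) + (de - eta * a)%N%:Z = dT by [].
  rewrite mulNrn -mulr_natr natz -PoszM mulnBr.
  rewrite -!subzn ?leq_mul2l ?a_le ?orbT //; last lia.
  by rewrite deltaE //; lia.
have pXE t x : pX.@[coords (t, x)] =
    if x is Some y then \prod_(i < a) (y - (enum F)`_i * h t) else (a == dX)%:R.
  have [_ _ e2 e3] := coords_ix (t, x).
  rewrite mevalM rmorphXn rmorph_prod /= mevalXU e2.
  under eq_bigr => i _ do rewrite mevalB mevalZ mevalM hE !mevalXU e2 e3.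
  case: x {e2 e3} => [y|] /=.
    by rewrite expr1n mul1r; apply: eq_bigr => i _; rewrite mul1r.
  rewrite big1 => [|i _]; last by rewrite mul0r mulr0 subr0.
  by rewrite mulr1 expr0n; congr (nat_of_bool _)%:R; lia.
have pTE t x : pT.@[coords (t, x)] =
    if t is Some y then \prod_(j < b) (y - (enum F)`_j * 1)
    else (eta * a + b == de)%:R.
  have [e0 e1 _ _] := coords_ix (t, x).
  rewrite mevalM rmorphXn rmorph_prod /= mevalXU e0.
  under eq_bigr => i _ do rewrite mevalB mevalZ !mevalXU e0 e1.
  case: t {e0 e1} => [y|] /=; first by rewrite expr1n mul1r.
  rewrite big1 => [|i _]; last by rewrite mulr0 subr0.
  by rewrite mulr1 expr0n; congr (nat_of_bool _)%:R; lia.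
rewrite (card_pairs (fun P => (pX * pT).@[coords P] != 0)) /footprint_weight /=.
have nz (B : bool) : (B%:R != 0 :> F) = B by case: B; rewrite ?oner_eq0 ?eqxx.
(* The value of pT does not depend on x, so [None] is an arbitrary choice here. *)
transitivity (\sum_t (q - a + (a == dX)) * (pT.@[coords (t, None)] != 0%R))%N.
  apply: eq_bigr => t _.
  have [pT0|pT0] := eqVneq pT.@[coords (t, None)] 0%R.
    rewrite muln0; apply/eqP; rewrite cards_eq0; apply/eqP/setP => x.
    by rewrite !inE mevalM pTE -(pTE t None) pT0 mulr0 eqxx.
  rewrite muln1 (card_option_set (fun x => (pX * pT).@[coords (t, x)] != 0)).
  have mE x : ((pX * pT).@[coords (t, x)] != 0) = (pX.@[coords (t, x)] != 0).
    by rewrite mevalM pTE -(pTE t None) mulf_eq0 (negPf pT0) orbF.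
  rewrite mE pXE nz -(card_nonroots_translates a (h0 t)); congr (_ + _)%N.
  by apply: eq_card => x; rewrite !inE mE pXE.
rewrite -big_distrr /=; congr (_ * _)%N.
rewrite -(card_nonroots_translates b (oner_neq0 F)).
transitivity #|[set t | pT.@[coords (t, None)] != 0]|.
  by rewrite -sum1dep_card [RHS]big_mkcond; apply: eq_bigr => t _; case: ifP.
rewrite (card_option_set (fun t => pT.@[coords (t, None)] != 0)) pTE nz.
by congr (_ + _)%N; apply: eq_card => x; rewrite !inE pTE.
Qed.

End MinimalWord.

(** * Minimum distance and comparison of the two minima *)

Lemma codeP (F : finFieldType) (eta : nat) (dT : int) (dX : nat)
    (c : {ffun Pt F -> F}) :
  reflect (exists p, in_R eta dT dX p /\ c = evalcode p) (c \in code F eta dT dX).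
Proof.
rewrite inE /bool_of_Prop.
by case: ClassicalDescription.excluded_middle_informative => h; constructor.
Qed.

Lemma hammingE (F : finFieldType) (p p' : {mpoly F[4]}) :
  hamming (evalcode p) (evalcode p') = #|[set P | (p - p').@[coords P] != 0]|.
Proof.
by apply: eq_card => P; rewrite !inE !ffunE mevalB subr_eq0.
Qed.

(** Distances are weights of differences. The first hypothesis takes care of the default value in
    [dmin]. *)
Lemma leq_dmin (F : finFieldType) (eta : nat) (dT : int) (dX m : nat) :
  (m <= #|Pt F|)%N ->
  (forall p, in_R eta dT dX p -> (exists P, p.@[coords P] != 0) ->
     (m <= #|[set P : Pt F | p.@[coords P] != 0%R]|)%N) ->
  (m <= dmin F eta dT dX)%N.
Proof.
move=> m_le wt_ge; apply: leq_bigminn => // c _ /codeP[p [pR ->]].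
apply: leq_bigminn => // c' _ /andP[/codeP[p' [pR' ->]] neq].
rewrite hammingE; apply: wt_ge; first exact: in_RB.
apply/existsP; apply: contraNT neq; rewrite negb_exists => /forallP all0.
apply/eqP/ffunP => P; rewrite !ffunE; apply/esym/eqP.
by rewrite -subr_eq0 -mevalB; have := all0 P; rewrite negbK.
Qed.

(** The word is compared with the zero word; positive weight makes the two distinct, so that the
    pair enters the minimum. *)
Lemma dmin_leq (F : finFieldType) (eta : nat) (dT : int) (dX : nat) p :
  in_R eta dT dX p -> (0 < #|[set P : Pt F | p.@[coords P] != 0%R]|)%N ->
  (dmin F eta dT dX <= #|[set P : Pt F | p.@[coords P] != 0%R]|)%N.
Proof.
move=> pR wt_gt0; set z := evalcode (0 : {mpoly F[4]}).
have wtE : hamming (evalcode p) z = #|[set P | p.@[coords P] != 0]|.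
  by rewrite hammingE subr0.
have zC : z \in code F eta dT dX.
  by apply/codeP; exists 0; split=> // m; rewrite msupp0.
have pC : evalcode p \in code F eta dT dX by apply/codeP; exists p.
rewrite -wtE in wt_gt0 *.
have neq : z != evalcode p.
  apply: contraTneq wt_gt0 => ->; rewrite -leqNgt leqn0 cards_eq0.
  by apply/eqP/setP => P; rewrite !inE eqxx.
apply: leq_trans (bigminn_leq _ _ (mem_index_enum (evalcode p)) pC) _.
by apply: bigminn_leq; rewrite ?mem_index_enum // zC.
Qed.

Lemma bound_leq (q eta : nat) (dT : int) (dX : nat) (eT : int) (eX : nat) ab :
  ab \in Kstar q eta dT dX ->
  (bound q eta dT dX eT eX <= divcount q eta eT eX (Mmono eta dT dX ab))%N.
Proof.
by move=> abK; apply: bigminn_leq => //; rewrite mem_undup map_f.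
Qed.

(** The default in [bound] is the count for the head of the list, a genuine element because ab0
    makes the list nonempty. *)
Lemma leq_bound (q eta : nat) (dT : int) (dX : nat) (eT : int) (eX m : nat) ab0 :
  ab0 \in Kstar q eta dT dX ->
  (forall ab, ab \in Kstar q eta dT dX ->
     (m <= divcount q eta eT eX (Mmono eta dT dX ab))%N) ->
  (m <= bound q eta dT dX eT eX)%N.
Proof.
move=> ab0K le; set s := Deltastar q eta dT dX.
have le_s M : M \in s -> (m <= divcount q eta eT eX M)%N.
  by rewrite mem_undup => /mapP[ab /le leab ->].
apply: leq_bigminn => [|M /le_s //]; apply: le_s.
have : Mmono eta dT dX ab0 \in s by rewrite mem_undup map_f.
by rewrite -/s; case: (s) => //= M s' _; rewrite mem_head.
Qed.

Theorem theorem2 (F : finFieldType) (q eta : nat) (dT : int) (dX : nat) :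
  #|F| = q -> eta != 1%N -> 0 <= dT + (eta * dX)%:Z ->
  (forall eT eX : nat, (q <= eT)%N -> (q <= eX)%N ->
     (bound q eta dT dX eT%:Z eX <= dmin F eta dT dX)%N)
  /\ dmin F eta dT dX
     = bound q eta dT dX (Posz (addn (absz (dT + (eta * dX)%:Z)) q)) (dX + q)%N.
Proof.
move=> cardF eta1 de0; have q0 : (0 < q)%N := ltnW (cardF_gt1 cardF).
have K00 : (0, 0)%N \in Kstar q eta dT dX.
  by apply: Kstar_small; rewrite ?muln0 ?q0.
have lower eT eX : (q <= eT)%N -> (q <= eX)%N ->
    (bound q eta dT dX eT%:Z eX <= dmin F eta dT dX)%N.
  move=> qT qX.
  have bound_le ab : ab \in Kstar q eta dT dX ->
      (bound q eta dT dX eT%:Z eX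
       <= footprint_weight q eta (deltan eta dT dX) dX ab)%N.
    case: ab => a b abK.
    exact: leq_trans (bound_leq _ _ abK) (divcount_le _ de0 q0 qX abK).
  apply: leq_dmin => [|p pR nz].
    (* The default #|Pt| is bounded below through the weight of the word attached to (0, 0). *)
    have [a0 ab0] := Kstar_box de0 q0 K00.
    have [p _ wt] := footprint_word cardF eta1 de0 a0 ab0.
    by apply: leq_trans (bound_le _ K00) _; rewrite -wt max_card.
  have [ab abK wt] := weight_ge_footprint cardF eta1 de0
    (X2_value_form de0 pR) (X2_value_out de0 pR)
    (f := fun P => p.@[coords P])
    (meval_affine de0 pR) (meval_infinity de0 pR) nz.
  exact: leq_trans (bound_le _ abK) wt.
split=> //; apply/eqP; rewrite eqn_leq lower ?leq_addl // andbT.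
(* For this choice of eT and eX each count equals the weight of an explicit nonzero word. *)
apply: leq_bound K00 _ => -[a b] abK.
rewrite divcount_eq ?leq_addl //.
have [aX abE] := Kstar_box de0 q0 abK.
have [p pR wt] := footprint_word cardF eta1 de0 aX abE.
by rewrite -wt; apply: dmin_leq pR _; rewrite wt footprint_weight_gt0.
Qed.
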